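(* If $(a_1,a_2)\in\Sigma$, then $\chi(a_1,a_2)=4$ if $(a_1,a_2)=(1,2)$, and $\chi(a_1,a_2)=3$ otherwise.
   Context: $\Sigma$ is the set of strictly increasing sequences $a_1<\dots<a_n$ of positive integers with $\gcd(a_1,\dots,a_n)=1$. For $S=\{\pm a_1,\dots,\pm a_n\}$, the Schreier graph $G_S$ has vertex set $F(2^\mathbb{Z})=\{x\in2^\mathbb{Z}: s\cdot x\ne x\ \forall s\ne0\}$ with $(s\cdot x)(m)=x(m+s)$, and $x,y$ adjacent iff $s\cdot x=y$ for some $s\in S$. $\chi(a_1,\dots,a_n)$ is the Borel chromatic number of $G_S$ (least size of a finite discrete set $K$ admitting a Borel proper coloring $F(2^\mathbb{Z})\to K$). *)

(* Defs.v *)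
From mathcomp Require Import all_boot all_order all_algebra.
From mathcomp Require Import all_classical all_reals all_analysis.

Set Implicit Arguments.
Unset Strict Implicit.
Unset Printing Implicit Defensive.

Import GRing.Theory.

Local Open Scope classical_set_scope.

Section BorelColoring.
Context {X : topologicalType}.

Definition borel_set : set X -> Prop := <<s @open X >>.

(* K is discrete, so each of its subsets is open. *)
Definition borel_map_discrete (K : finType) (c : X -> K) : Prop :=
  forall A : set K, borel_set (c @^-1` A).

Definition proper_coloring (G : X -> X -> Prop) (K : Type) (c : X -> K) : Prop :=
  forall x y : X, G x y -> c x <> c y.

Definition borel_colorable (G : X -> X -> Prop) (k : nat) : Prop :=
  exists K : finType, #|K| = k /\
    exists c : X -> K, borel_map_discrete c /\ proper_coloring G c.

(* The Borel chromatic number need not exist as a natural number, so it is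
   given as a (functional) relation. *)
Definition borel_chromatic_number_is (G : X -> X -> Prop) (k : nat) : Prop :=
  borel_colorable G k /\ forall j : nat, borel_colorable G j -> (k <= j)%N.

End BorelColoring.

Definition two_pow_Z : topologicalType := prod_topology (fun _ : int => bool).

Definition shift_act (s : int) (x : two_pow_Z) : two_pow_Z :=
  fun m : int => x (m + s)%R.

Definition free_part : set two_pow_Z :=
  [set x | forall s : int, s <> 0%R -> shift_act s x <> x].

(* Through the coercion of sets to types, [free_part] below is the subtype
   carrying the topology induced by that of [two_pow_Z]. *)
Definition schreier_graph (S : set int) (x y : free_part) : Prop :=
  exists2 s : int, S s & shift_act s (set_val x) = set_val y.

Definition Sigma : set (seq nat) :=
  [set a | [/\ all (fun i => 0 < i)%N a, sorted ltn a
             & (\big[gcdn/0]_(i <- a) i = 1)%N]].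

Definition sym_gens (a : seq nat) : set int :=
  [set s | exists2 i : nat, i \in a & s = Posz i \/ s = (- Posz i)%R].

Definition chi_is (a : seq nat) (k : nat) : Prop :=
  borel_chromatic_number_is (schreier_graph (sym_gens a)) k.

(* Main.v *)
(* Lower bound. With 2 colours, or with 3 colours for (1,2), the colour of x is
   forced to be invariant under the shift by 2 a1, resp. by 3. By Baire category a
   Borel colour class is comeager in some cylinder, and invariance under one
   nontrivial shift then makes it meet its image under every shift, in particular
   that by a generator.

   Upper bound. Suppose that Z has colourings c_0, ..., c_J of period n such that
   neighbours differ within each c_j and also between c_j and c_(j+1), and that
   c_J is the shift of c_0 by some s coprime to n. Between two consecutive points
   of a sufficiently sparse Borel marker set, one passes through the c_j, spending
   a2 positions on each, a number of times that makes the last one match c_0 at the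
   next marker. If l divides neither generator, the residues mod l can be recoloured
   one class at a time with l + 1 colours; this covers (1,2) with l = 3 and two odd
   generators with l = 2. Otherwise a1 + a2 >= 5 is odd, modulo a1 + a2 the graph is
   an odd cycle, and three local recolourings rotate a suitable 3-colouring of it
   by two steps. *)
Require Import Defs.
From mathcomp Require Import all_boot all_order all_algebra zify.
From mathcomp Require Import all_classical all_reals all_analysis.

Set Implicit Arguments.
Unset Strict Implicit.
Unset Printing Implicit Defensive.

Import GRing.Theory.
Local Open Scope classical_set_scope.

(** * Cylinders and shifts in [two_pow_Z] *)

Definition agree (n : nat) (x y : two_pow_Z) : Prop :=
  forall m : int, (absz m <= n)%N -> x m = y m.

Lemma agree_sym n x y : agree n x y -> agree n y x.
Proof. by move=> xy m /xy. Qed.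

Lemma agree_trans n y x z : agree n x y -> agree n y z -> agree n x z.
Proof. by move=> xy yz m mn; rewrite xy ?yz. Qed.

Lemma agree_leq n n' x y : (n <= n')%N -> agree n' x y -> agree n x y.
Proof. by move=> nn' xy m mn; apply: xy; apply: leq_trans nn'. Qed.

Lemma shift_act0 x : shift_act 0 x = x.
Proof. by apply/funext => m; rewrite /shift_act addr0. Qed.

Lemma shift_actD s t x : shift_act s (shift_act t x) = shift_act (s + t)%R x.
Proof. by apply/funext => m; rewrite /shift_act addrA. Qed.

Lemma shift_agree n s x y :
  agree (n + absz s) x y -> agree n (shift_act s x) (shift_act s y).
Proof. by move=> xy m mn; apply: xy; lia. Qed.

Lemma free_shift s x : free_part x -> free_part (shift_act s x).
Proof.
move=> fx t t0 e; apply: (fx t t0).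
have := congr1 (shift_act (- s)) e.
by rewrite !shift_actD addrAC addNr add0r shift_act0.
Qed.

Arguments free_shift s {x}.

Lemma agree_nbhs n (x : two_pow_Z) : nbhs x (agree n x).
Proof.
have coord (m : int) : nbhs x [set y : two_pow_Z | y m = x m].
  have := @proj_continuous int (fun=> bool) m x [set x m].
  by apply; apply: open_nbhs_nbhs; split => //; exact: discrete_open.
elim: n => [|n IH].
  by apply: filterS (coord 0%R) => y y0 m m0; rewrite (_ : m = 0%R)//; lia.
apply: filterS (filterI IH (filterI (coord n.+1) (coord (- (n.+1)%:Z)%R))).
move=> y [xy [yp yn]] m mn.
have [/xy//|mn'] := leqP (absz m) n.
have [->|->] : m = n.+1 \/ m = (- (n.+1)%:Z)%R by lia.
  by rewrite yp.
by rewrite yn.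
Qed.

Lemma open_agreeP (U : set two_pow_Z) :
  open U <-> forall x, U x -> exists n, agree n x `<=` U.
Proof.
split=> [oU x Ux|H]; last first.
  rewrite openE => x /H[n nU]; apply: filterS nU _; exact: agree_nbhs.
(* Convergence in a product is coordinatewise, so the filter of cylinders about [x] converges to [x]
   and hence contains [U]. *)
pose F := filter_from [set: nat] (fun n => agree n x).
have FF : Filter F.
  apply: filter_from_filter; first by exists 0%N.
  move=> i j _ _; exists (maxn i j) => // y xy.
  by split; apply: agree_leq xy; rewrite ?leq_maxl ?leq_maxr.
have Fx : F --> x.
  apply/cvg_sup => i A [B [[C oC <-] Cx CA]].
  exists (absz i) => // y xy; apply: CA.
  by rewrite /= -xy.
have [] := Fx U; first by apply: open_nbhs_nbhs.
by move=> n _ nU; exists n.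
Qed.

(** * Closure properties of Borel sets *)

Section BorelSets.
Context {X : topologicalType}.

Lemma borel_open (A : set X) : open A -> borel_set A.
Proof. exact: sub_sigma_algebra. Qed.

Lemma borel_set0 : borel_set (set0 : set X).
Proof. by apply: borel_open; exact: open0. Qed.

Lemma borel_setC (A : set X) : borel_set A -> borel_set (~` A).
Proof.
move=> bA; have [_ + _] := smallest_sigma_algebra (@setT X) open.
by rewrite -setTD; apply.
Qed.

Lemma borel_bigcup (I : countType) (P : set I) (A : I -> set X) :
  (forall i, P i -> borel_set (A i)) -> borel_set (\bigcup_(i in P) A i).
Proof.
move=> bA.
pose B n := if unpickle n is Some i then [set x | P i /\ A i x] else set0.
have -> : \bigcup_(i in P) A i = \bigcup_n B n.
  apply/seteqP; split=> x.
    by case=> i Pi Aix; exists (pickle i) => //; rewrite /B pickleK.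
  by case=> n _; rewrite /B; case: unpickle => // i [Pi Ai]; exists i.
have [_ _] := smallest_sigma_algebra (@setT X) open; apply=> n.
rewrite /B; case: unpickle => [i|]; last exact: borel_set0.
have [Pi|nPi] := pselect (P i).
  by rewrite (_ : [set _ | _] = A i); [exact: bA|apply/seteqP; split=> x //= []].
by rewrite (_ : [set _ | _] = set0); [exact: borel_set0|apply/seteqP; split=> x //= []].
Qed.

Lemma borel_bigcap (I : countType) (P : set I) (A : I -> set X) :
  (forall i, P i -> borel_set (A i)) -> borel_set (\bigcap_(i in P) A i).
Proof.
move=> bA; rewrite -[X in borel_set X]setCK setC_bigcap.
by apply: borel_setC; apply: borel_bigcup => i Pi; apply: borel_setC; exact: bA.
Qed.

Lemma borel_setI (A B : set X) :
  borel_set A -> borel_set B -> borel_set (A `&` B).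
Proof.
move=> bA bB; have -> : A `&` B = \bigcap_(b : bool) (if b then A else B).
  apply/seteqP; split=> [x [Ax Bx] [] //|x H].
  by split; [exact: (H true)|exact: (H false)].
by apply: borel_bigcap => -[].
Qed.

Lemma borel_setU (A B : set X) :
  borel_set A -> borel_set B -> borel_set (A `|` B).
Proof.
move=> bA bB; rewrite -[X in borel_set X]setCK setCU.
by apply: borel_setC; apply: borel_setI; apply: borel_setC.
Qed.

End BorelSets.

Lemma borel_preimage (X Y : topologicalType) (f : X -> Y) (A : set Y) :
  continuous f -> borel_set A -> borel_set (f @^-1` A).
Proof.
move=> /continuousP cf; move: A.
suff : <<s @open Y >> `<=` [set A | borel_set (f @^-1` A)] by [].
apply: smallest_sub => [|U oU]; last by apply: borel_open; exact: cf.
split=> [|A bA|A bA]; rewrite /mkset.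
- by rewrite preimage_set0; exact: borel_set0.
- by rewrite setTD preimage_setC; apply: borel_setC.
- by rewrite preimage_bigcup; apply: borel_bigcup => i _; exact: bA.
Qed.

Lemma shift_continuous s : continuous (shift_act s).
Proof.
apply/continuousP => U /open_agreeP oU; apply/open_agreeP => x /oU[n nU].
by exists (n + absz s)%N => y xy; apply/nU/shift_agree.
Qed.

Lemma borel_shift s A : borel_set A -> borel_set (shift_act s @^-1` A).
Proof. by apply: borel_preimage; exact: shift_continuous. Qed.

Lemma borel_free_part (A : set two_pow_Z) :
  borel_set A -> borel_set (set_val @^-1` A : set free_part).
Proof. by apply: borel_preimage; exact: initial_continuous. Qed.

(* Every window pattern agrees with [decode p] for some [p], so there are only
   countably many cylinders. *)
Definition decode (p : nat * seq bool) : two_pow_Z :=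
  fun m => nth false p.2 (absz (m + Posz p.1)%R).

Lemma decode_surj n x : exists w, agree n x (decode (n, w)).
Proof.
exists (mkseq (fun i => x (Posz i - Posz n)%R) (n + n).+1) => m mn.
rewrite /decode /= nth_mkseq; last by lia.
by congr x; lia.
Qed.

Lemma borel_agree n x : borel_set (agree n x).
Proof.
apply: borel_open; apply/open_agreeP => y xy; exists n => z; exact: agree_trans.
Qed.

(** * Baire category *)

Definition dense_interior (D : set two_pow_Z) : Prop :=
  forall x n, exists y n', [/\ (n <= n')%N, agree n x y & agree n' y `<=` D].

Definition comeager (C : set two_pow_Z) : Prop :=
  exists2 D : nat -> set two_pow_Z,
    forall k, dense_interior (D k) & \bigcap_k D k `<=` C.

Lemma dense_interiorT : dense_interior setT.
Proof. by move=> x n; exists x, n. Qed.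

Lemma dense_interior_comeager D : dense_interior D -> comeager D.
Proof. by move=> dD; exists (fun=> D) => // z Dz; exact: (Dz 0%N I). Qed.

Lemma comeagerS (A B : set two_pow_Z) : A `<=` B -> comeager A -> comeager B.
Proof. by move=> AB [D dD DA]; exists D => //; apply: subset_trans AB. Qed.

Lemma comeager_bigcap (T : countType) (C : T -> set two_pow_Z) :
  (forall i, comeager (C i)) -> comeager (\bigcap_i C i).
Proof.
move=> cC.
have /choice[D DP] : forall i : T, exists D : nat -> set two_pow_Z,
    (forall k, dense_interior (D k)) /\ \bigcap_k D k `<=` C i.
  by move=> i; have [D] := cC i; exists D.
exists (fun k => if unpickle k is Some (i, j) then D i j else setT) => [k|z Dz i _].
  case: unpickle => [[i j]|]; [exact: (DP i).1|exact: dense_interiorT].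
apply: (DP i).2 => j _; have := Dz (pickle (i, j)) I.
by rewrite /= pickleK.
Qed.

Lemma comeagerI (A B : set two_pow_Z) :
  comeager A -> comeager B -> comeager (A `&` B).
Proof.
move=> cA cB; apply: (@comeagerS (\bigcap_(b : bool) (if b then A else B))).
  by move=> z H; split; [exact: (H true)|exact: (H false)].
by apply: comeager_bigcap => -[].
Qed.

Lemma comeager_shift s C : comeager C -> comeager (shift_act s @^-1` C).
Proof.
move=> [D dD DC]; exists (fun k => shift_act s @^-1` D k) => [k x n|z Dz].
  have [y [n' [nn' xy yD]]] := dD k (shift_act s x) (n + absz s)%N.
  exists (shift_act (- s)%R y), (n' + absz s)%N; split; first by lia.
    move=> m mn; rewrite /shift_act -xy /shift_act; last by lia.
    by rewrite subrK.
  move=> z yz; apply: yD => m mn; rewrite /shift_act -yz; last by lia.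
  by rewrite /shift_act addrK.
by apply: DC => k _; exact: Dz.
Qed.

(** Cylinders are nested inside the successive [D k] with strictly growing radii; the witness is
    their common point. *)
Lemma baire C x n : comeager C -> exists2 z, agree n x z & C z.
Proof.
move=> [D dD DC].
have /choice[f fP] : forall p : nat * (two_pow_Z * nat), exists q : two_pow_Z * nat,
    [/\ (p.2.2 < q.2)%N, agree p.2.2 p.2.1 q.1 & agree q.2 q.1 `<=` D p.1].
  move=> [k [y l]] /=; have [y' [l' [ll' yy' y'D]]] := dD k y l.
  exists (y', l'.+1); split=> //= z yz; apply: y'D.
  by apply: agree_leq yz.
pose g := fix g k := if k is k'.+1 then f (k', g k') else (x, n).
have gP k : [/\ ((g k).2 < (g k.+1).2)%N, agree (g k).2 (g k).1 (g k.+1).1 &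
  agree (g k.+1).2 (g k.+1).1 `<=` D k] by exact: (fP (k, g k)).
have kg k : (k <= (g k).2)%N.
  by elim: k => // k IH; have [+ _ _] := gP k; exact: leq_ltn_trans.
have chain k l : (k <= l)%N -> agree (g k).2 (g k).1 (g l).1 /\ ((g k).2 <= (g l).2)%N.
  elim: l => [|l IH]; first by rewrite leqn0 => /eqP ->.
  rewrite leq_eqVlt => /orP[/eqP -> //|/IH[kl kl']].
  have [/ltnW ll' aa _] := gP l; split; last exact: leq_trans ll'.
  by apply: agree_trans kl _; exact: agree_leq aa.
(* The radius at stage [k] is at least [k], so coordinate [m] is settled by stage [absz m]. *)
pose z : two_pow_Z := fun m => (g (absz m)).1 m.
have gz k : agree (g k).2 (g k).1 z.
  move=> m mk; rewrite /z; have [km|mk'] := leqP k (absz m).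
    by have [-> //] := chain _ _ km.
  by have [-> //] := chain _ _ (ltnW mk'); apply: kg.
exists z; first exact: (gz 0%N).
by apply: DC => k _; have [_ _] := gP k; apply.
Qed.

Lemma free_part_comeager : comeager free_part.
Proof.
apply: (@comeagerS (\bigcap_(s : int) [set z | s <> 0%R -> shift_act s z <> z])).
  by move=> z H s; exact: H.
apply: comeager_bigcap => s; apply: dense_interior_comeager.
have [->|/eqP s0] := eqVneq s 0%R; first by move=> x n; exists x, n; split=> // z _ [].
move=> x n.
(* Position [n.+1] lies outside the window and receives the opposite of the value at [n.+1 + s],
   which breaks invariance under [s]. *)
exists (fun m : int => if m == Posz n.+1 then ~~ x (Posz n.+1 + s)%R else x m).
exists (n.+1 + absz s)%N; split; first by lia.
  by move=> m mn; case: eqP => // mn'; lia.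
move=> z yz _ /(congr1 (fun u : two_pow_Z => u (Posz n.+1))).
rewrite /shift_act -yz; last by lia.
rewrite -yz; last by lia.
rewrite eqxx; case: eqP => [e|_]; first by lia.
by case: (x _).
Qed.

(* [A], read inside [2^Z], has its free points comeager in the window of [x]. *)
Definition forces (x : two_pow_Z) (n : nat) (A : set free_part) : Prop :=
  comeager [set z | agree n x z ->
    free_part z /\ forall y : free_part, set_val y = z -> A y].

Lemma forces_sub x n A B : A `<=` B -> forces x n A -> forces x n B.
Proof.
move=> AB; apply: comeagerS => z H /H[fz Az]; split=> // y /Az; exact: AB.
Qed.

(** Cylinders forcing [A] are dense below the window; as there are countably many, the comeager
    conditions they impose hold simultaneously. *)
Lemma forces_locally x n A :
  (forall y n', (n <= n')%N -> agree n x y ->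
    exists y' n'', [/\ (n' <= n'')%N, agree n' y y' & forces y' n'' A]) ->
  forces x n A.
Proof.
move=> H.
pose D := [set z | agree n x z -> exists2 p, forces (decode p) p.1 A & agree p.1 (decode p) z].
have dD : dense_interior D.
  move=> y n1.
  have [xy|nxy] := pselect (agree n x y); last first.
    exists y, (maxn n n1); split=> //; first exact: leq_maxr.
    move=> z yz xz; exfalso; apply: nxy; apply: agree_trans xz _.
    by apply: agree_sym; apply: agree_leq yz; exact: leq_maxl.
  have [y' [n'' [n1n'' yy' fA]]] := H y (maxn n n1) (leq_maxl _ _) xy.
  exists y', n''; split; first by apply: leq_trans n1n''; exact: leq_maxr.
    by apply: agree_leq yy'; exact: leq_maxr.
  move=> z y'z _; have [w y'w] := decode_surj n'' y'.
  exists (n'', w) => /=; last exact: agree_trans (agree_sym y'w) y'z.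
  apply: comeagerS fA => t ft wt; apply: ft; exact: agree_trans y'w wt.
pose E (p : nat * seq bool) := [set z | forces (decode p) p.1 A ->
  agree p.1 (decode p) z -> free_part z /\ forall y : free_part, set_val y = z -> A y].
have cE : comeager (\bigcap_p E p).
  apply: comeager_bigcap => p.
  have [fp|nfp] := pselect (forces (decode p) p.1 A).
    by apply: comeagerS fp => z Hz _.
  apply: (@comeagerS setT); last exact: dense_interior_comeager dense_interiorT.
  by move=> z _ /nfp.
apply: comeagerS (comeagerI (dense_interior_comeager dD) cE).
move=> z [Dz Ez] /Dz[p fp pz]; exact: (Ez p I fp pz).
Qed.

(** A local form of the Baire property. *)
Definition decided (A : set free_part) : Prop :=
  forall x n, exists y n', [/\ (n <= n')%N, agree n x y &
    forces y n' A \/ forces y n' (~` A)].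

Lemma open_decided A : open A -> decided A.
Proof.
move=> [U oU <-] x n.
have [[y xy Uy]|nU] := pselect (exists2 y, agree n x y & U y).
  have [k kU] := (open_agreeP U).1 oU y Uy.
  exists y, (maxn n k); split; [exact: leq_maxl|by []|left].
  apply: comeagerS free_part_comeager => z fz yz; split=> // t /= ->.
  by apply: kU; apply: agree_leq yz; exact: leq_maxr.
exists x, n; split=> //; right.
apply: comeagerS free_part_comeager => z fz xz; split=> // t /= tz Ut.
by apply: nU; exists z; rewrite // -tz.
Qed.

(** The decided sets form a sigma-algebra containing the open sets. *)
Lemma borel_decided A : borel_set A -> decided A.
Proof.
move: A; suff : <<s @open free_part >> `<=` decided by [].
apply: smallest_sub; last exact: open_decided.
split=> [|A dA|A dA].
- by apply: open_decided; exact: open0.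
- move=> x n; have [y [n' [nn' xy dec]]] := dA x n.
  exists y, n'; split=> //; rewrite setTD setCK.
  by case: dec; [right|left].
move=> x n.
(* If no smaller cylinder forces the union, none forces any [A k]; each complement is then forced
   densely, hence in the whole window. *)
have [[y [n' [nn' xy fy]]]|nf] := pselect (exists y n',
  [/\ (n <= n')%N, agree n x y & forces y n' (\bigcup_k A k)]).
  by exists y, n'; split=> //; left.
exists x, n; split=> //; right.
have cA : comeager (\bigcap_k [set z | agree n x z ->
    free_part z /\ forall y : free_part, set_val y = z -> (~` A k) y]).
  apply: comeager_bigcap => k; apply: forces_locally => y n' nn' xy.
  have [y' [n'' [n'n'' yy' [fA|fA]]]] := dA k y n'; last by exists y', n''.
  exfalso; apply: nf; exists y', n''; split; first exact: leq_trans n'n''.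
    by apply: agree_trans xy _; exact: agree_leq yy'.
  by apply: forces_sub fA => t At; exists k.
apply: comeagerS cA => z Hz xz; split; first exact: (Hz 0%N I xz).1.
by move=> y yz [k _ Ak]; exact: (Hz k I xz).2 yz Ak.
Qed.

(** Otherwise the complements of all colour classes would be forced in one window, and some free
    point there would have no colour. *)
Lemma color_forced (K : finType) (c : free_part -> K) :
  borel_map_discrete c -> exists i x n, forces x n (c @^-1` [set i]).
Proof.
move=> bc; apply: contrapT => nf.
have cC : comeager (\bigcap_i [set z | agree 0 (fun=> false) z -> free_part z /\
    forall y : free_part, set_val y = z -> (~` (c @^-1` [set i])) y]).
  apply: comeager_bigcap => i; apply: forces_locally => y n _ _.
  have [y' [n' [nn' yy' [fA|fA]]]] := borel_decided (bc [set i]) y n.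
    by exfalso; apply: nf; exists i, y', n'.
  by exists y', n'.
have [z az [Cz fz]] := baire (fun=> false) 0%N (comeagerI cC free_part_comeager).
pose y : free_part := exist _ z (mem_set fz).
by have [_] := Cz (c y) I az; move/(_ y); apply; rewrite // set_valE.
Qed.

(* A colour class comeager in a window is moved by a large multiple of [N], which
   preserves it, away from its image under the shift by [s]; both then meet. *)
Lemma borel_color_repeats (K : finType) (c : free_part -> K) (N : nat) (s : int) :
  borel_map_discrete c -> (0 < N)%N ->
  (forall x y : free_part, shift_act N (set_val x) = set_val y -> c x = c y) ->
  exists x y : free_part, shift_act s (set_val x) = set_val y /\ c x = c y.
Proof.
move=> bc N0 cN; have [i [y [n fy]]] := color_forced bc.
pose t : int := (N * (2 * n + absz s).+1)%N.
have tn : (2 * n + absz s < absz t)%N.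
  by rewrite /t /=; apply: leq_pmull.
(* Since [t] exceeds [2 * n + absz s], the windows of radius [n] about [s] and [t] are disjoint, and
   [w] can carry the pattern of [y] in both. *)
pose w : two_pow_Z := fun m =>
  if (absz (m - s)%R <= n)%N then y (m - s)%R else y (m - t)%R.
pose F := [set z | agree n y z ->
    free_part z /\ forall x : free_part, set_val x = z -> (c @^-1` [set i]) x].
have [z wz [[Fs Ft] fz]] := baire w (n + absz s + absz t)%N
  (comeagerI (comeagerI (comeager_shift s fy) (comeager_shift t fy)) free_part_comeager).
have ws : agree n y (shift_act s z).
  move=> m mn; rewrite /shift_act -wz; last by lia.
  by rewrite /w addrK mn.
have wt : agree n y (shift_act t z).
  move=> m mn; rewrite /shift_act -wz; last by lia.
  by rewrite /w addrK; case: ifP => // mn'; lia.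
pose pt u (fu : free_part u) : free_part := exist _ u (mem_set fu).
have ptE u fu : set_val (@pt u fu) = u by rewrite set_valE.
have iter k : c (pt _ (free_shift (N * k)%N fz)) = c (pt _ fz).
  elim: k => [|k IH].
    move: (free_shift _ fz); rewrite muln0 shift_act0 => fz'.
    by rewrite (Prop_irrelevance fz' fz).
  rewrite -IH; apply: esym; apply: cN; rewrite !ptE shift_actD.
  by rewrite mulnS PoszD.
exists (pt _ fz), (pt _ (free_shift s fz)); split; first by rewrite !ptE.
have /= [_ /(_ _ (ptE _ (free_shift s fz))) /= ->] := Fs ws.
have /= [_ /(_ _ (ptE _ (free_shift t fz))) /= <-] := Ft wt.
by rewrite -(iter (2 * n + absz s).+1).
Qed.

(** * Stages of periodic colourings *)

Section AvoidDivisor.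
Variable l : nat.
Hypothesis l_gt1 : (1 < l)%N.

(* The stages of a passage from [m mod l] to its shift: at each stage one
   residue class takes the colour left free. *)
Definition resid_coloring (j m : nat) : nat :=
  (j + (m + (l - 1) * j) %% l) %% l.+1.

Lemma resid_coloring_lt j m : (resid_coloring j m < l.+1)%N.
Proof. exact: ltn_pmod. Qed.

Lemma resid_coloring_period j m : resid_coloring j (m + l) = resid_coloring j m.
Proof. by rewrite /resid_coloring addnAC modnDr. Qed.

Lemma resid_coloring_twist j m :
  resid_coloring (j + l.+1) m = resid_coloring j (m + (l - 1)).
Proof.
rewrite /resid_coloring -addnA [(l.+1 + _)%N]addnC addnA modnDr.
rewrite (_ : m + (l - 1) * (j + l.+1) = (l - 1) * l + (m + (l - 1) + (l - 1) * j))%N.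
  by rewrite modnMDl.
by nia.
Qed.

(** From one stage to the next the summand [j] gains one and the residue mod [l] loses one, so a
    colour changes only where the residue wraps from 0 to [l - 1]. *)
Lemma resid_coloring_proper j m t : ~~ (l %| t)%N ->
  resid_coloring j m <> resid_coloring j (m + t) /\
  resid_coloring j m <> resid_coloring j.+1 (m + t).
Proof.
move=> lt; rewrite /resid_coloring.
set u := (m + _)%N.
have ne : (u %% l <> (u + t) %% l)%N.
  move=> /eqP; rewrite eq_sym -{2}[u]addn0 eqn_modDl mod0n => h.
  by rewrite /dvdn h in lt.
have l0 : (0 < l)%N by lia.
have u1 := ltn_pmod u l0; have u2 := ltn_pmod (u + t)%N l0.
split.
  rewrite (_ : m + t + _ = u + t)%N; last by rewrite /u; lia.
  by move/eqP; rewrite eqn_modDl (modn_small (leqW u1)) (modn_small (leqW u2)) => /eqP.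
set v := (m + t + _)%N.
have ev : (v.+1 %% l = (u + t) %% l)%N.
  by rewrite (_ : v.+1 = u + t + l)%N ?modnDr// /u /v; nia.
have v1 := ltn_pmod v l0.
have sv : ((v %% l).+1 %% l.+1 = (v %% l).+1)%N by rewrite modn_small.
rewrite addSnnS => /eqP; rewrite eqn_modDl (modn_small (leqW u1)) sv.
move=> /eqP e; apply: ne. rewrite e -ev.
by rewrite -[in RHS]addn1 -modnDml addn1 [RHS]modn_small -e.
Qed.
End AvoidDivisor.

Section OddCycle.
Variables a b : nat.
Let n := (a + b)%N.
Hypotheses (n_odd : odd n) (n_ge5 : (5 <= n)%N).

(* Recolouring the vertices 2, 1, 0 of the cycle 0, ..., n-1, in this order,
   turns the colouring 2,0,1,0,1,...,0,1 into its rotation by two steps. *)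
Definition cycle_coloring (j i : nat) : nat :=
  match i with
  | 0 => if (j < 3)%N then 2 else 0
  | 1 => if (j < 2)%N then 0 else 1
  | 2 => if (j < 1)%N then 1 else 2
  | _ => if odd i then 0 else 1
  end.

Lemma cycle_coloring_lt j i : (cycle_coloring j i < 3)%N.
Proof. by case: i => [|[|[|i]]] /=; repeat case: ifP. Qed.

Lemma cycle_coloring3 i : (i < n)%N ->
  cycle_coloring 3 i = cycle_coloring 0 ((i + (n - 2)) %% n).
Proof.
move=> i_n.
(* Indices 0 and 1 rotate to [n - 2] and [n - 1]; this is where the parity of [n] enters. *)
have [i2|i2] := ltnP i 2; last first.
  rewrite (_ : i + (n - 2) = i - 2 + n)%N; last by lia.
  rewrite modnDr modn_small; last by lia.
  by case: i i_n i2 => [|[|[|[|[|i]]]]] //= _ _; rewrite ?subSS ?subn0 /= ?negbK.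
rewrite modn_small; last by lia.
by case: i i2 {i_n} => [|[|]] // _; move: n_ge5 n_odd; rewrite ?add0n ?add1n;
  case: n => [|[|[|[|[|k]]]]] //= _; rewrite ?negbK ?subSS ?subn0 /= => h;
  rewrite ?negbK ?h ?(negbTE h).
Qed.

(** There are two mixed inequalities because generator [a] moves forward along the cycle and [b]
    backward. *)
Lemma cycle_coloring_step j i : (j < 3)%N -> (i < n)%N ->
  [/\ cycle_coloring j i <> cycle_coloring j (i.+1 %% n),
      cycle_coloring j i <> cycle_coloring j.+1 (i.+1 %% n) &
      cycle_coloring j.+1 i <> cycle_coloring j (i.+1 %% n)].
Proof.
move=> j3; rewrite leq_eqVlt => /orP[/eqP i_n|i_n].
  rewrite i_n modnn; move: n_ge5 n_odd; rewrite -i_n.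
  by case: i i_n => [|[|[|[|i]]]] //= _ _; rewrite ?negbK => h;
    rewrite ?negbK ?h ?(negbTE h); case: j j3 => [|[|[|]]].
rewrite modn_small//; case: i i_n => [|[|[|i]]] _;
  case: j j3 => [|[|[|]]] //= _; by case: (odd i).
Qed.

(* [alpha * m] is the place of [m] on the cycle of multiples of [a] modulo
   [n]; since [b = - a] modulo [n], both differences are steps of the cycle. *)
Definition wound_coloring (alpha j m : nat) : nat :=
  cycle_coloring (j %% 3) ((alpha * m + (n - 2) * (j %/ 3)) %% n).

Lemma wound_coloring_period alpha j m :
  wound_coloring alpha j (m + n) = wound_coloring alpha j m.
Proof. by rewrite /wound_coloring mulnDr addnAC addnC modnMDl. Qed.

Variable alpha : nat.
Hypothesis alphaE : (alpha * a %% n = 1)%N.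

(** Three stages rotate the cycle by [n - 2]; as [alpha * a] is 1 modulo [n], translation by
    [a * (n - 2)] does the same. *)
Lemma wound_coloring_twist j m :
  wound_coloring alpha (j + 3) m = wound_coloring alpha j (m + a * (n - 2)).
Proof.
rewrite /wound_coloring modnDr; congr cycle_coloring.
rewrite divnDr// divnn /= mulnDr muln1 mulnDr mulnA addnA [in RHS]addnAC.
rewrite -[in RHS]modnDmr -[in X in (_ = (_ + X) %% _)%N]modnMml alphaE mul1n.
by rewrite modnDmr.
Qed.

(** Reading the next stage as stage 3 when [j %% 3 = 2] keeps consecutive stages within one
    rotation, so that [cycle_coloring_step] applies. *)
Lemma wound_coloringS j m : wound_coloring alpha j.+1 m =
  cycle_coloring (j %% 3).+1 ((alpha * m + (n - 2) * (j %/ 3)) %% n).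
Proof.
have n0 : (0 < n)%N by lia.
have j3 := ltn_pmod j (isT : 0 < 3)%N.
have [j2|j2] : (j %% 3 < 2)%N \/ (j %% 3 = 2)%N by lia.
  rewrite /wound_coloring.
  have -> : (j.+1 %% 3 = (j %% 3).+1)%N by lia.
  by have -> : (j.+1 %/ 3 = j %/ 3)%N by lia.
rewrite j2 cycle_coloring3 ?ltn_pmod// /wound_coloring modnDml.
have -> : (j.+1 %% 3 = 0)%N by lia.
have -> : (j.+1 %/ 3 = (j %/ 3).+1)%N by lia.
by rewrite mulnS addnA addnAC.
Qed.

Lemma wound_coloring_proper j m t : t = a \/ t = b ->
  wound_coloring alpha j m <> wound_coloring alpha j (m + t) /\
  wound_coloring alpha j m <> wound_coloring alpha j.+1 (m + t).
Proof.
have n0 : (0 < n)%N by lia.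
have j3 := ltn_pmod j (isT : 0 < 3)%N.
pose pos x := (alpha * x + (n - 2) * (j %/ 3))%N.
have step x : (pos (x + a) = (pos x %% n).+1 %[mod n])%N.
  rewrite /pos mulnDr addnAC -modnDmr alphaE addn1 -[in RHS]addn1.
  by rewrite modnDml addn1.
have lt x := ltn_pmod (pos x) n0.
rewrite !wound_coloringS /wound_coloring -!/(pos _).
case=> ->.
  by have [? ? _] := cycle_coloring_step j3 (lt m); rewrite step.
(* As [b] is [- a] modulo [n], [m] is one step ahead of [m + b] on the cycle. *)
have back : (pos m = (pos (m + b)%N %% n).+1 %[mod n])%N.
  rewrite -step /pos -addnA [(b + a)%N]addnC -/n.
  by rewrite [in RHS]mulnDr [in RHS]addnAC [in RHS]addnC modnMDl.
have [h _ h'] := cycle_coloring_step j3 (lt (m + b)%N).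
by rewrite back; split=> /esym.
Qed.
End OddCycle.

(** * Markers *)

Section Markers.
Variable r : nat.

Definition small_shift : set int := [set s | s <> 0%R /\ (absz s < r)%N].

Definition sparse (A : set two_pow_Z) : Prop :=
  forall x s, A x -> small_shift s -> ~ A (shift_act s x).

Definition sparse_cylinder (k : nat) : set two_pow_Z :=
  if unpickle k is Some p then
    [set x | agree (p : nat * seq bool).1 (decode p) x
             /\ sparse (agree p.1 (decode p))]
  else set0.

Lemma sparse_cylinder_sparse k : sparse (sparse_cylinder k).
Proof.
rewrite /sparse_cylinder; case: unpickle => // p x s [px sp] ss [psx _].
exact: sp px ss psx.
Qed.

Lemma borel_sparse_cylinder k : borel_set (sparse_cylinder k).
Proof.
rewrite /sparse_cylinder; case: unpickle => [p|]; last exact: borel_set0.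
have [sp|nsp] := pselect (sparse (agree p.1 (decode p))).
  rewrite (_ : [set _ | _] = agree p.1 (decode p)); first exact: borel_agree.
  by apply/seteqP; split=> x // [].
rewrite (_ : [set _ | _] = set0); first exact: borel_set0.
by apply/seteqP; split=> x // [].
Qed.

(** A free point differs from each of its finitely many small shifts at some coordinate; a window
    containing all these coordinates gives a sparse cylinder. *)
Lemma sparse_cylinder_cover x : free_part x -> exists k, sparse_cylinder k x.
Proof.
move=> fx.
have moved (s : int) : exists m : int, s <> 0%R -> x (m + s)%R <> x m.
  have [->|/eqP s0] := eqVneq s 0%R; first by exists 0%R.
  apply: contrapT => /forallNP H; apply: (fx s s0); apply/funext => m.
  by apply: contrapT => ne; apply: (H m).
have /choice[f fP] := moved.
(* The sum covers the witnesses for both signs; the extra [r] leaves room for the moved coordinate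
   [f s + s]. *)
pose N := (\sum_(i < r) (absz (f (Posz i)) + absz (f (- Posz i)%R)) + r)%N.
have fN s : small_shift s -> (absz (f s) + r <= N)%N.
  move=> [_ sr]; rewrite /N leq_add2r (bigD1 (Ordinal sr)) //= -addnA.
  have [e|e] : s = absz s \/ s = (- Posz (absz s))%R by lia.
    by rewrite {1}e leq_addr.
  by rewrite {1}e; lia.
have [w xw] := decode_surj N x.
exists (pickle (N, w)); rewrite /sparse_cylinder pickleK; split=> /=.
  exact: agree_sym.
move=> y s wy ss wsy; have sN := fN s ss.
case: ss => s0 sr; apply: (fP s s0).
rewrite xw; last by lia.
rewrite wy; last by lia.
rewrite xw; last by lia.
by rewrite wsy; last by lia.
Qed.

(* Greedy construction, which makes the set of markers maximal: a free point lies
   in some [sparse_cylinder k], and is refused at stage [k] only for a marker nearby. *)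
Fixpoint marker_stage (k : nat) : set two_pow_Z :=
  if k is k'.+1 then
    marker_stage k' `|`
    (sparse_cylinder k' `&`
     \bigcap_(s in small_shift) ~` (shift_act s @^-1` marker_stage k'))
  else set0.

Lemma borel_marker_stage k : borel_set (marker_stage k).
Proof.
elim: k => [|k IH] /=; first exact: borel_set0.
apply: borel_setU => //; apply: borel_setI; first exact: borel_sparse_cylinder.
by apply: borel_bigcap => s _; apply: borel_setC; exact: borel_shift.
Qed.

Lemma small_shiftN s : small_shift s -> small_shift (- s)%R.
Proof. by rewrite /small_shift /=; lia. Qed.

Lemma marker_stage_sparse k : sparse (marker_stage k).
Proof.
elim: k => [|k IH] //= x s [Mx|[Ux nMx]] ss [Msx|[Usx nMsx]].
- exact: IH Mx ss Msx.
- apply: (nMsx (- s)%R); first exact: small_shiftN.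
  by rewrite /= shift_actD addNr shift_act0.
- exact: (nMx s ss Msx).
- exact: sparse_cylinder_sparse Ux ss Usx.
Qed.

Lemma marker_stage_leq k l : (k <= l)%N -> marker_stage k `<=` marker_stage l.
Proof.
elim: l => [|l IH]; first by rewrite leqn0 => /eqP ->.
by rewrite leq_eqVlt => /orP[/eqP ->//|/IH kl x /kl]; left.
Qed.

Definition markers : set two_pow_Z := \bigcup_k marker_stage k.

Lemma borel_markers : borel_set markers.
Proof. by apply: borel_bigcup => k _; exact: borel_marker_stage. Qed.

Lemma markers_sparse : sparse markers.
Proof.
move=> x s [k _ Mx] ss [l _ Msx].
apply: (marker_stage_sparse (k := maxn k l) _ ss).
  exact: marker_stage_leq (leq_maxl _ _) _ Mx.
exact: marker_stage_leq (leq_maxr _ _) _ Msx.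
Qed.

Lemma markers_near x : free_part x ->
  exists2 s, (absz s <= r)%N & markers (shift_act s x).
Proof.
move=> /sparse_cylinder_cover[k Ux].
have [[s ss Ms]|nM] := pselect (exists2 s, small_shift s & marker_stage k (shift_act s x)).
  by exists s; [case: ss; lia|exists k].
exists 0%R => //; rewrite shift_act0; exists k.+1 => //=; right; split=> // s ss Ms.
by apply: nM; exists s.
Qed.

(** A gap contains its left marker, where [d = 0], but not its right one; its length is
    [d + e.+1]. *)
Definition between_markers (d e : nat) : set two_pow_Z :=
  [set x | [/\ markers (shift_act (- d%:Z)%R x), markers (shift_act e.+1 x) &
    forall i : int, (- d%:Z < i < e.+1)%R -> ~ markers (shift_act i x)]].

Lemma borel_between_markers d e : borel_set (between_markers d e).
Proof.
rewrite (_ : between_markers d e = shift_act (- d%:Z)%R @^-1` markers `&`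
  (shift_act e.+1 @^-1` markers `&`
   \bigcap_(i in [set i : int | - d%:Z < i < e.+1]%R) ~` (shift_act i @^-1` markers))).
  apply: borel_setI; first exact: borel_shift borel_markers.
  apply: borel_setI; first exact: borel_shift borel_markers.
  by apply: borel_bigcap => i _; apply: borel_setC; exact: borel_shift borel_markers.
by apply/seteqP; split=> x; [case=> Md Me M|case=> Md [Me M]]; split.
Qed.

Lemma between_markers_exists x : free_part x -> exists d e, between_markers d e x.
Proof.
move=> fx.
have exd : exists d : nat, `[< markers (shift_act (- d%:Z)%R x) >].
  (* Searching around [- r] yields a marker at a position at most 0; searching around [r.+1] below
     yields one at a positive position. *)
  have [s sr] := markers_near (free_shift (- r%:Z)%R fx).
  rewrite shift_actD => M; exists (absz (s - r%:Z)%R); apply/asboolP.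
  by rewrite (_ : (- _)%R = (s - r%:Z)%R)//; lia.
have exe : exists e : nat, `[< markers (shift_act e.+1 x) >].
  have [s sr] := markers_near (free_shift r.+1 fx).
  rewrite shift_actD => M; exists (absz (s + r%:Z)%R); apply/asboolP.
  by rewrite [X in shift_act X](_ : _ = (s + r.+1%:Z)%R)//; lia.
case: (ex_minnP exd) => d /asboolP Md mind.
case: (ex_minnP exe) => e /asboolP Me mine.
exists d, e; split=> // i id Mi.
have [i0|i0] : (i <= 0)%R \/ (0 < i)%R by lia.
  have := mind (absz i); rewrite (_ : (- _)%R = i); last by lia.
  by move=> /(_ (asboolT Mi)); lia.
have := mine (absz (i - 1)%R); rewrite [X in shift_act X](_ : _ = i); last by lia.
by move=> /(_ (asboolT Mi)); lia.
Qed.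

Lemma between_markers_inj x d e d' e' :
  between_markers d e x -> between_markers d' e' x -> d = d' /\ e = e'.
Proof.
move=> [Md Me M] [Md' Me' M'].
split; apply/eqP; rewrite eqn_leq; apply/andP; split; rewrite leqNgt; apply/negP => lt.
- by apply: (M (- d'%:Z)%R) => //; lia.
- by apply: (M' (- d%:Z)%R) => //; lia.
- by apply: (M e'.+1) => //; lia.
- by apply: (M' e.+1) => //; lia.
Qed.

Lemma between_markers_gap d e x : between_markers d e x -> (r <= d + e.+1)%N.
Proof.
move=> [Md Me _]; rewrite leqNgt; apply/negP => lt.
apply: (markers_sparse (s := (d + e.+1)%N) Md); first by rewrite /small_shift /=; lia.
by rewrite shift_actD (_ : (_ + - _)%R = Posz e.+1)//; lia.
Qed.

Lemma between_markers_same d e x t : between_markers d e x -> (t <= e)%N ->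
  between_markers (d + t) (e - t) (shift_act t x).
Proof.
move=> [Md Me M] te; split; rewrite ?shift_actD.
- by rewrite (_ : (_ + _)%R = - d%:Z)%R//; lia.
- by rewrite (_ : (_ + _)%R = Posz e.+1)//; lia.
- by move=> i ie; rewrite shift_actD; apply: M; lia.
Qed.

(** As [t <= r], sparseness excludes a second marker between [e.+1] and [t]. *)
Lemma between_markers_next d e x t d' e' : between_markers d e x ->
  (e < t)%N -> (t <= r)%N -> between_markers d' e' (shift_act t x) ->
  d' = (t - e.+1)%N.
Proof.
move=> [_ Me _] et tr [Md' _ M'].
have ne : (d' <= t - e.+1)%N.
  rewrite leqNgt; apply/negP => lt; apply: (M' (e.+1%:Z - t%:Z)%R); first by lia.
  by rewrite shift_actD subrK.
apply/eqP; rewrite eqn_leq ne /= leqNgt; apply/negP => lt.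
apply: (markers_sparse (s := (t - d' - e.+1)%N) Me); first by rewrite /small_shift /=; lia.
move: Md'; rewrite !shift_actD.
by rewrite (_ : (_ + _)%R = ((t - d' - e.+1)%N%:Z + e.+1%:Z)%R)//; lia.
Qed.

End Markers.

(** * Gluing periodic colourings between markers *)

Section StagedColoring.
Variables (K : finType) (a b n s J : nat) (c : nat -> nat -> K).
Hypotheses (a_gt0 : (0 < a)%N) (ab : (a <= b)%N) (n_gt0 : (0 < n)%N).
Hypothesis sn_coprime : coprime s n.
Hypothesis period : forall j m, c j (m + n)%N = c j m.
Hypothesis twist : forall j m, c (j + J)%N m = c j (m + s)%N.
Hypothesis proper : forall j m t, t = a \/ t = b ->
  c j m <> c j (m + t)%N /\ c j m <> c j.+1 (m + t)%N.

Lemma turns_exists g : exists k, (k < n)%N && (n %| g + k * s)%N.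
Proof.
have [u _ +] := Bezoutl s n_gt0; rewrite gcdnC (eqP sn_coprime) => nu.
(* Here [u * s] is -1 modulo [n], so [g + g * u * s] vanishes. *)
exists ((g * u) %% n)%N; rewrite ltn_pmod//= /dvdn -modnDmr modnMml modnDmr.
by rewrite -mulnA -mulnS -add1n -/(dvdn _ _) dvdn_mull.
Qed.

(* Passing [k] times through the stages [0, ..., J] shifts the colouring by [k * s];
   [turns g] passages make it fit the start of the next gap after [g] steps. *)
Definition turns g : nat := ex_minn (turns_exists g).

Lemma turns_lt g : (turns g < n)%N.
Proof. by rewrite /turns; case: ex_minnP => k /andP[]. Qed.

Lemma turns_dvd g : (n %| g + turns g * s)%N.
Proof. by rewrite /turns; case: ex_minnP => k /andP[]. Qed.

(** The stage advances every [b] positions after the left marker and then rests at [turns g * J]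
    until the gap ends. *)
Definition gap_coloring (g d : nat) : K := c (minn (turns g * J) (d %/ b)) d.

Lemma period_mul j m q : c j (m + q * n)%N = c j m.
Proof.
by elim: q => [|q IH]; rewrite ?mul0n ?addn0// mulSn addnCA addnC period.
Qed.

Lemma twist_mul k m : c (k * J)%N m = c 0%N (m + k * s)%N.
Proof.
elim: k m => [|k IH] m; first by rewrite !mul0n addn0.
by rewrite mulSn addnC twist IH mulSn addnA.
Qed.

(** A step of length at most [b] advances the stage by at most one. *)
Lemma gap_coloring_proper g d t : t = a \/ t = b ->
  gap_coloring g d <> gap_coloring g (d + t)%N.
Proof.
move=> tab; rewrite /gap_coloring; set i := minn _ _; set j := minn _ _.
have tb : (t <= b)%N by case: tab => ->.
have b0 : (0 < b)%N by apply: leq_trans ab.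
have lo : (d %/ b <= (d + t) %/ b)%N by apply: leq_div2r; apply: leq_addr.
have hi : ((d + t) %/ b <= (d %/ b).+1)%N.
  apply: (@leq_trans ((d + b) %/ b)%N); first by apply: leq_div2r; rewrite leq_add2l.
  by rewrite divnDr ?dvdnn// divnn b0 addn1.
have [-> | ->] : j = i \/ j = i.+1 by rewrite /i /j; lia.
  by have [] := proper i d tab.
by have [] := proper i d tab.
Qed.

Lemma gap_coloring_next g g' d d' t : t = a \/ t = b ->
  (b * (n * J).+1 <= g)%N -> (d < g)%N -> (d + t = g + d')%N ->
  gap_coloring g d <> gap_coloring g' d'.
Proof.
move=> tab gb dg e.
have tb : (t <= b)%N by case: tab => ->.
have b0 : (0 < b)%N by apply: leq_trans ab.
(* The step has length at most [b], so [d' < b] is still at stage 0, while [d] is at least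
   [b * (n * J)] and has reached the final stage. *)
rewrite /gap_coloring [(d' %/ b)%N]divn_small; last by lia.
rewrite minn0 (minn_idPl _); last first.
  rewrite leq_divRL//; apply: (@leq_trans (n * J * b)%N); last by lia.
  by rewrite !leq_mul2r ltnW ?orbT// turns_lt.
have /dvdnP[q qE] := turns_dvd g.
rewrite -(period_mul 0 d' q) -qE (_ : d' + (g + _) = d + t + turns g * s)%N; last by lia.
by rewrite -twist_mul; have [] := proper (turns g * J) d tab.
Qed.

Lemma staged_borel_colorable :
  borel_colorable (schreier_graph (sym_gens [:: a; b])) #|K|.
Proof.
exists K; split=> //.
pose r := (b * (n * J).+1)%N.
have /choice[p pP] : forall x : free_part, exists p : nat * nat,
    between_markers r p.1 p.2 (set_val x).
  move=> x; have fx : free_part (set_val x) by exact (set_valP x).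
  by have [d [e de]] := between_markers_exists r fx; exists (d, e).
pose col q := gap_coloring (q.1 + q.2.+1)%N q.1.
exists (fun x => col (p x)); split=> [A|].
  (* Although [p] comes from choice, its values are unique, so colour classes are countable unions
     of Borel sets. *)
  have -> : (fun x => col (p x)) @^-1` A = \bigcup_(q in [set q | A (col q)])
      (set_val @^-1` between_markers r q.1 q.2 : set free_part).
    apply/seteqP; split=> [x Ax|x [q Aq qx]]; first by exists (p x); [exact: Ax|exact: pP].
    have [e1 e2] := between_markers_inj (pP x) qx.
    by rewrite /= [p x]surjective_pairing e1 e2 -surjective_pairing.
  by apply: borel_bigcup => q _; apply: borel_free_part; exact: borel_between_markers.
have pos t (x y : free_part) : t = a \/ t = b ->
    shift_act (Posz t) (set_val x) = set_val y -> col (p x) <> col (p y).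
  move=> tab xy; have px := pP x; have := pP y; rewrite -xy => py.
  have tb : (t <= b)%N by case: tab => ->.
  have [te|et] := leqP t (p x).2.
    have [e1 e2] := between_markers_inj (between_markers_same px te) py.
    rewrite /col -e1 -e2.
    rewrite (_ : (p x).1 + t + ((p x).2 - t).+1 = (p x).1 + (p x).2.+1)%N; last by lia.
    exact: gap_coloring_proper.
  have tr : (t <= r)%N by apply: leq_trans tb _; rewrite /r mulnS leq_addr.
  have d'E := between_markers_next px et tr py.
  apply: (gap_coloring_next tab).
  - exact: between_markers_gap px.
  - by rewrite addnS ltnS leq_addr.
  - by rewrite d'E; lia.
move=> x y [u [t]]; rewrite !inE => tab ut xy.
have {}tab : t = a \/ t = b by move/orP: tab => [] /eqP; [left|right].
case: ut xy => -> xy; first exact: (pos t).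
move=> /esym; apply: (pos t) => //.
by rewrite -xy shift_actD subrr shift_act0.
Qed.

End StagedColoring.

(** * Upper bounds from the two staged colourings *)

Lemma borel_colorable_not_dvd a b l : (0 < a)%N -> (a <= b)%N -> (1 < l)%N ->
  ~~ (l %| a)%N -> ~~ (l %| b)%N ->
  borel_colorable (schreier_graph (sym_gens [:: a; b])) l.+1.
Proof.
move=> a0 ab l1 la lb; rewrite -[X in borel_colorable _ X]card_ord.
apply: (@staged_borel_colorable 'I_l.+1 a b l (l - 1) l.+1
  (fun j m => Ordinal (resid_coloring_lt l j m))) => //; first by lia.
- by rewrite subn1 coprime_sym coprimenP; lia.
- by move=> j m; apply: val_inj; exact: resid_coloring_period.
- by move=> j m; apply: val_inj; exact: resid_coloring_twist.
- move=> j m t tab; have lt : ~~ (l %| t)%N by case: tab => ->.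
  have [ne neS] := resid_coloring_proper l1 j m lt.
  by split=> /(congr1 val).
Qed.

Lemma borel_colorable_odd_sum a b : (0 < a)%N -> (a <= b)%N -> coprime a b ->
  odd (a + b) -> (5 <= a + b)%N ->
  borel_colorable (schreier_graph (sym_gens [:: a; b])) 3.
Proof.
move=> a0 ab cab oab n5.
have can : coprime a (a + b) by rewrite /coprime gcdnDl.
have [alpha alphaE] : exists alpha, (alpha * a %% (a + b) = 1)%N.
  have n0 : (0 < a + b)%N by lia.
  have [u _] := Bezoutl a n0; rewrite gcdnC (eqP can) => /dvdnP[q qE].
  (* Bezout makes [u * a] equal to -1 modulo [a + b]; the factor [a + b - 1] changes the sign. *)
  exists ((a + b - 1) * u)%N.
  have -> : ((a + b - 1) * u * a = (u * a - q) * (a + b) + 1)%N by nia.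
  by rewrite modnMDl modn_small//; lia.
rewrite -[X in borel_colorable _ X]card_ord.
apply: (@staged_borel_colorable 'I_3 a b (a + b) (a * (a + b - 2)) 3
  (fun j m => Ordinal (cycle_coloring_lt _ _ : wound_coloring a b alpha j m < 3)%N)).
- by [].
- by [].
- by lia.
(* A common divisor of [a + b - 2] and [a + b] divides 2, and [a + b] is odd. *)
- rewrite coprimeMl can /=.
  rewrite -[X in coprime _ X](@subnK 2)/=; last by lia.
  by rewrite /coprime gcdnDl -/(coprime _ _) coprimen2 oddB ?oab//; lia.
- by move=> j m; apply: val_inj; exact: wound_coloring_period.
- by move=> j m; apply: val_inj; exact: wound_coloring_twist.
- move=> j m t tab.
  have [ne neS] := wound_coloring_proper oab n5 alphaE j m tab.
  by split=> /(congr1 val).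
Qed.

(** * Lower bounds and the chromatic numbers *)

Lemma free_part_shift s (x : free_part) :
  exists y : free_part, set_val y = shift_act s (set_val x).
Proof.
have fx : free_part (set_val x) by exact (set_valP x).
move: (shift_act s _) (free_shift s fx) => u fu.
pose y : free_part := exist _ u (mem_set fu).
by exists y; rewrite set_valE.
Qed.

Lemma schreier_shift (a b t : nat) (x y : free_part) : t \in [:: a; b] ->
  set_val y = shift_act t (set_val x) -> schreier_graph (sym_gens [:: a; b]) x y.
Proof. by move=> tab xy; exists (Posz t); [exists t; [by []|left]|rewrite xy]. Qed.

Lemma uniq_size_card (T : finType) (s : seq T) : uniq s -> (size s <= #|T|)%N.
Proof. by move=> /card_uniqP <-; exact: max_card. Qed.

(** With two colours, a point and its shift by [2 * a] both avoid the colour of the point halfway,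
    so they agree. *)
Lemma borel_colorable_ge3 a b k : (0 < a)%N ->
  borel_colorable (schreier_graph (sym_gens [:: a; b])) k -> (3 <= k)%N.
Proof.
move=> a0 [K [<- [c [bc pc]]]]; rewrite leqNgt; apply/negP => K3.
have step (x y : free_part) : set_val y = shift_act a (set_val x) -> c x <> c y.
  by move=> xy; apply/pc/(schreier_shift _ xy); rewrite inE eqxx.
have [||x [y [xy cxy]]] := @borel_color_repeats K c (2 * a) a bc.
- by rewrite muln_gt0.
- move=> x y xy; have [z xz] := free_part_shift a x.
  have zy : set_val y = shift_act a (set_val z).
    by rewrite xz shift_actD -xy mul2n -addnn.
  apply: contrapT => /eqP nxy.
  have : uniq [:: c x; c z; c y].
    rewrite /= !inE negb_or nxy andbT.
    by move/eqP: (step _ _ xz) => ->; move/eqP: (step _ _ zy) => ->.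
  by move=> /uniq_size_card; rewrite /= leqNgt K3.
by apply: (step x y).
Qed.

(** Among four consecutive points only the two ends are not adjacent, so with three colours the ends
    agree. *)
Lemma borel_colorable12_ge4 k :
  borel_colorable (schreier_graph (sym_gens [:: 1; 2])) k -> (4 <= k)%N.
Proof.
move=> [K [<- [c [bc pc]]]]; rewrite leqNgt; apply/negP => K4.
have step1 (x y : free_part) : set_val y = shift_act 1%N (set_val x) -> c x != c y.
  by move=> xy; apply/eqP/pc/(schreier_shift _ xy).
have step2 (x y : free_part) : set_val y = shift_act 2%N (set_val x) -> c x != c y.
  by move=> xy; apply/eqP/pc/(schreier_shift _ xy).
have [//||x [y [xy cxy]]] := @borel_color_repeats K c 3 1%N bc.
  move=> x y xy; have [u xu] := free_part_shift 1%N x; have [v xv] := free_part_shift 2%N x.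
  have uv : set_val v = shift_act 1%N (set_val u) by rewrite xu shift_actD.
  have uy : set_val y = shift_act 2%N (set_val u) by rewrite xu shift_actD.
  have vy : set_val y = shift_act 1%N (set_val v) by rewrite xv shift_actD.
  apply: contrapT => /eqP nxy.
  have : uniq [:: c x; c u; c v; c y].
    by rewrite /= !inE !negb_or nxy (step1 _ _ xu) (step1 _ _ uv) (step1 _ _ vy)
      (step2 _ _ xv) (step2 _ _ uy).
  by move=> /uniq_size_card; rewrite /= leqNgt K4.
by move: (step1 x y (esym xy)); rewrite cxy eqxx.
Qed.

Theorem theorem6p1 (a1 a2 : nat) (ha : Sigma [:: a1; a2]) :
  ((a1, a2) = (1, 2)%N -> chi_is [:: a1; a2] 4) /\
  ((a1, a2) <> (1, 2)%N -> chi_is [:: a1; a2] 3).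
Proof.
case: ha => /= /andP[a1_gt0 _] /andP[lt12 _].
rewrite !big_cons big_nil gcdn0 => cop.
split=> [[-> ->]|ne12].
  split; last exact: borel_colorable12_ge4.
  exact: (@borel_colorable_not_dvd 1 2 3).
split; last by move=> j; exact: borel_colorable_ge3.
have [odd_sum|] := boolP (odd (a1 + a2)).
  apply: borel_colorable_odd_sum => //; [exact: ltnW|exact/eqP|].
  (* If [a1 = 1], then [a2] is even and not 2, so at least 4; otherwise [a1 >= 2] and [a2 >= 3]. *)
  have [a1_1|a1_gt1] : a1 = 1%N \/ (1 < a1)%N by lia.
    move: odd_sum ne12 lt12; rewrite a1_1.
    by case: a2 {cop} => [|[|[|[|a]]]] //= _; case.
  by lia.
rewrite oddD negb_add => /eqP e12.
(* Equal parities and gcd 1 make both generators odd, so [l = 2] divides neither. *)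
have o1 : odd a1.
  apply: contraT => e1; have : (2 %| gcdn a1 a2)%N by rewrite dvdn_gcd !dvdn2 -e12 e1.
  by rewrite cop.
by apply: borel_colorable_not_dvd; rewrite ?dvdn2 ?negbK -?e12// ltnW.
Qed.
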